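(* Let $c>0$ be fixed. Then there exists $n_0$ such that for every $n\ge n_0$, every graph $G$ on $n$ vertices with minimum degree at least $cn$ satisfies $f(G)\le \frac{122n}{c^2}$, i.e. $G$ has a separating path system of cardinality at most $\frac{122n}{c^2}$.
   Context: For a graph $G$, a family $\mathcal{P}$ of subsets of $E(G)$ is a separating path system of $G$ if every member of $\mathcal{P}$ is (the edge set of) a path in $G$, and for every pair of distinct edges $e,e'\in E(G)$ there is some $P\in\mathcal{P}$ containing exactly one of $e,e'$. $f(G)$ denotes the minimum size of a separating path system of $G$. *)

(* Defs.v *)
From mathcomp Require Import all_boot all_order all_algebra.
From mathcomp Require Import reals.
Set Implicit Arguments. Unset Strict Implicit. Unset Printing Implicit Defensive.
Import Order.TTheory GRing.Theory Num.Theory.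
Local Open Scope ring_scope.

Definition simple_graph (n : nat) (adj : rel 'I_n) : Prop :=
  symmetric adj /\ irreflexive adj.

Definition edges (n : nat) (adj : rel 'I_n) : {set {set 'I_n}} :=
  [set e : {set 'I_n} | [exists x, exists y, adj x y && (e == [set x; y])]].

Definition is_path_edges (n : nat) (adj : rel 'I_n) (F : {set {set 'I_n}}) : Prop :=
  exists (x : 'I_n) (s : seq 'I_n),
    [/\ path adj x s, uniq (x :: s) &
        F = [set [set p.1; p.2] | p in zip (x :: s) s]].

Definition separating_path_system (n : nat) (adj : rel 'I_n)
    (P : {set {set {set 'I_n}}}) : Prop :=
  (forall F, F \in P -> is_path_edges adj F) /\
  (forall e e', e \in edges adj -> e' \in edges adj -> e != e' ->
     exists2 F, F \in P & (e \in F) != (e' \in F)).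

Definition min_degree_ge (R : realType) (n : nat) (adj : rel 'I_n) (d : R) : Prop :=
  forall v : 'I_n, d <= (#|[set u | adj v u]|)%:R.

(* Main.v *)
Require Import Defs.
From mathcomp Require Import all_boot all_order all_algebra.
From mathcomp Require Import reals.
From mathcomp Require Import zify lra.
(** Fix a colouring of the edges in which every vertex sees each colour at most
    twice.  The core claim is that O(n / c^2) paths suffice for every edge to lie on
    a path containing no other edge of its colour.  Applying it to the injective
    colouring gives a family A covering all edges; colouring each edge by the first
    path of A through it and applying the claim again gives a family B.  Two edges
    with different first paths are separated by A, and two edges with the same first
    path are separated by B.

    For the claim, call two vertices close if they have at least d ~ c^2 n / 2 common
    neighbours; by inclusion-exclusion at most 2 / c vertices are pairwise not close.
    A tour threads up to d / 13 uncovered edges together, going from the end of one to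
    a close end of the next through a common neighbour chosen to avoid bad vertices
    and colours.  A tour that stops early is stuck at a vertex y: every uncovered edge
    with an end close to y meets the tour or repeats one of its colours.  These few
    edges are deferred, after which later tours end at vertices not close to y, so at
    most 2 / c tours get stuck.  The O(c n^2) deferred edges are split greedily into
    O(n / c) matchings of size less than d / 13 with distinct colours.  In such a
    matching nothing is ever deferred, so 2 / c tours cover it. *)

Set Implicit Arguments.
Unset Strict Implicit.
Unset Printing Implicit Defensive.

Import Order.TTheory GRing.Theory Num.Theory.

(** * Greedy colouring with bounded classes *)

Lemma cardsU_leq {T : finType} (A B : {set T}) : (#|A :|: B| <= #|A| + #|B|)%N.
Proof. by rewrite cardsU leq_subr. Qed.

(** Elements are coloured one at a time. The neighbours of the new element exclude at most [k]
    colours. At most [L] colours are full, since full classes are disjoint, have [b] elements each,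
    and [#|D| <= L * b]. So one of the [N > k + L] colours remains. *)
Lemma bounded_proper_colouring {T : finType} (r : rel T) (D : {set T}) k b L N :
  symmetric r -> {in D, forall e, #|[set f in D | r e f]| <= k}%N ->
  (0 < b -> #|D| <= L * b -> k + L < N ->
  exists f : T -> 'I_N, {in D &, forall e e', f e = f e' -> e != e' -> ~~ r e e'} /\
    forall i, #|[set e in D | f e == i]| <= b)%N.
Proof.
move=> rsym degD b0 DL kN; have i0 : 'I_N by exists 0%N; apply: leq_ltn_trans kN.
suff H j : forall A : {set T}, A \subset D -> #|A| = j -> exists f : T -> 'I_N,
    {in A &, forall e e', f e = f e' -> e != e' -> ~~ r e e'} /\
    forall i, (#|[set e in A | f e == i]| <= b)%N.
  exact: H (subxx _) (erefl _).
elim: j => [|j IHj] A AD cA.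
  move/eqP: cA; rewrite cards_eq0 => /eqP->; exists (fun=> i0).
  split=> [e e'|i]; first by rewrite inE.
  by rewrite (_ : [set _ in _ | _] = set0) ?cards0 //; apply/setP=> e; rewrite !inE.
have /set0Pn[e eA] : A != set0 by rewrite -cards_eq0 cA.
have sub : A :\ e \subset A := subD1set _ _.
have cAe : #|A :\ e| = j by move: cA; rewrite (cardsD1 e) eA => -[].
have [f [fr fb]] := IHj _ (subset_trans sub AD) cAe.
pose full := [set i | #|[set a in A :\ e | f a == i]| == b].
have cfull : (#|full| <= L)%N.
  rewrite -(leq_pmul2r b0); apply: leq_trans DL; apply: leq_trans (subset_leq_card AD).
  apply: leq_trans (subset_leq_card sub).
  rewrite -[leqRHS]sum1_card (partition_big f xpredT) //= -sum_nat_const.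
  rewrite [leqRHS](bigID (mem full)) /=; apply: leq_trans (leq_addr _ _).
  apply: leq_sum => i; rewrite inE => /eqP <-; rewrite sum1dep_card leq_eqVlt.
  by apply/orP; left; apply/eqP/eq_card => a; rewrite !inE.
pose bad := f @: [set a in D | r e a] :|: full.
have : (#|bad| < N)%N.
  apply: leq_ltn_trans (cardsU_leq _ _) _; apply: leq_ltn_trans kN; apply: leq_add => //.
  by apply: leq_trans (leq_imset_card _ _) (degD _ (subsetP AD _ eA)).
move=> badN; have /subsetPn[i _] : ~~ ([set: 'I_N] \subset bad).
  by apply/negP=> /subset_leq_card; rewrite cardsT card_ord leqNgt badN.
rewrite in_setU negb_or inE => /andP[ibad ifull].
have isafe a : a \in A -> f a = i -> ~~ r e a.
  move=> aA fa; apply: contra ibad => ra; apply/imsetP; exists a => //.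
  by rewrite inE (subsetP AD).
exists (fun a => if a == e then i else f a); split.
  move=> a a' aA a'A; case: eqVneq => [->|ae]; case: eqVneq => [->|a'e].
  - by [].
  - by move=> fi _; apply: isafe.
  - by move=> fi _; rewrite rsym; apply: isafe.
  - by apply: fr; rewrite in_setD1 ?ae ?a'e.
move=> i'; case: (eqVneq i' i) => [->|i'i].
  have -> : [set a in A | (if a == e then i else f a) == i]
      = e |: [set a in A :\ e | f a == i].
    by apply/setP=> a; rewrite !inE; case: (eqVneq a e) => [->|]; rewrite ?eA ?eqxx.
  rewrite cardsU1 !inE eqxx /= add1n ltn_neqAle fb andbT; exact: ifull.
apply: leq_trans (fb i'); apply/subset_leq_card/subsetP=> a; rewrite !inE.
by case: (eqVneq a e) => [_|//]; rewrite eq_sym (negPf i'i) andbF.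
Qed.

(** * Edge sequences of paths *)

Section Steps.
Context {V : finType}.
Implicit Types (x v w : V) (s : seq V).
Local Open Scope nat_scope.

(** With [pairmap], prepending vertices to a path unfolds by computation; [stepsE] gives the [zip]
    form of [is_path_edges]. *)
Definition steps x s : seq {set V} := pairmap (fun a b => [set a; b]) x s.

Lemma set2_inj v w a b :
  [set v; w] = [set a; b] -> v = a /\ w = b \/ v = b /\ w = a.
Proof.
move=> eq_e.
have: v \in [set a; b] by rewrite -eq_e set21.
have: w \in [set a; b] by rewrite -eq_e set22.
have: a \in [set v; w] by rewrite eq_e set21.
have: b \in [set v; w] by rewrite eq_e set22.
by rewrite !in_set2 => /orP[]/eqP-> /orP[]/eqP-> /orP[]/eqP? /orP[]/eqP?; subst; tauto.
Qed.

Lemma zip_nthP (x0 x : V) s a b :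
  (a, b) \in zip (x :: s) s ->
  exists2 i, i < size s & a = nth x0 (x :: s) i /\ b = nth x0 (x :: s) i.+1.
Proof.
move=> /(nthP (x0, x0))[i]; rewrite size_zip /= => lt_i.
have lti: i < size s by lia.
rewrite nth_zip_cond size_zip /= (_ : i < minn _ _ = true); last by lia.
by case=> <- <-; exists i.
Qed.

Lemma stepsE x s : steps x s = [seq [set p.1; p.2] | p <- zip (x :: s) s].
Proof. by elim: s x => //= y s IHs x; rewrite -IHs. Qed.

Lemma steps_degree x s v :
  uniq (x :: s) -> #|[set w | [set v; w] \in steps x s]| <= 2.
Proof.
move=> us; pose f i := nth x (x :: s) i.
(* Only the vertices just before and just after [v] can occur. Positions out of range fall back on
   harmless values, as only an inclusion is claimed. *)
have sub : [set w | [set v; w] \in steps x s] \subset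
    [set f (index v (x :: s)).+1; f (index v (x :: s)).-1].
  apply/subsetP=> w; rewrite inE stepsE => /mapP[[a b] /(zip_nthP x)[i lti [ea eb]]].
  rewrite in_set2; set k := index v _ => /set2_inj[[/= va wb]|[/= vb wa]].
    by rewrite /k va wb ea index_uniq ?eb ?eqxx //; apply: ltnW.
  by rewrite /k vb wa eb index_uniq // ea eqxx orbT.
by apply: leq_trans (subset_leq_card sub) _; rewrite cards2; case: eqP.
Qed.

End Steps.

(** * Edges of a coloured graph *)

Section Cover.
Context {V : finType} {C : eqType} (adj : rel V) (chi : {set V} -> C).
Context (adj_sym : symmetric adj) (adj_irr : irreflexive adj).
Local Open Scope nat_scope.
Implicit Types (x y z v w : V) (s : seq V) (e : {set V}) (Q R D : {set {set V}}) (Z : {set V}) (K : seq C).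

Definition graph_edges : {set {set V}} :=
  [set e : {set V} | [exists x, exists y, adj x y && (e == [set x; y])]].

Lemma graph_edgesP e :
  reflect (exists x y, adj x y /\ e = [set x; y]) (e \in graph_edges).
Proof.
rewrite inE; apply: (iffP existsP) => [[x /existsP[y /andP[xy /eqP->]]]|[x [y [xy ->]]]].
  by exists x, y.
by exists x; apply/existsP; exists y; rewrite xy eqxx.
Qed.

Lemma graph_edges_at e v :
  e \in graph_edges -> v \in e -> exists2 w, adj v w & e = [set v; w].
Proof.
case/graph_edgesP=> x [y [xy ->]]; rewrite in_set2 => /orP[]/eqP->; first by exists y.
by exists x; rewrite 1?adj_sym // setUC.
Qed.

Lemma card_edges_at v : #|[set e in graph_edges | v \in e]| <= #|V|.
Proof.
have sub : [set e in graph_edges | v \in e] \subset [set [set v; w] | w in V].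
  apply/subsetP=> e; rewrite inE => /andP[ee ve].
  by case: (graph_edges_at ee ve) => w _ ->; apply/imsetP; exists w.
by apply: leq_trans (subset_leq_card sub) _; apply: leq_imset_card.
Qed.

Lemma card_graph_edges : #|graph_edges| <= #|V| ^ 2.
Proof.
have sub : graph_edges \subset [set [set p.1; p.2] | p in {: V * V}].
  apply/subsetP=> e /graph_edgesP[x [y [_ ->]]].
  by apply/imsetP; exists (x, y).
apply: leq_trans (subset_leq_card sub) _.
by apply: leq_trans (leq_imset_card _ _) _; rewrite card_prod mulnn.
Qed.

(** Both bounds hold for the injective colouring, and for the colouring by first path because a path
    has at most two edges at a vertex and fewer than [#|V|] edges. *)
Context (chi_local : forall v a, #|[set w | adj v w && (chi [set v; w] == a)]| <= 2).
Context (chi_class : forall a, #|[set e in graph_edges | chi e == a]| <= #|V|).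

Lemma card_coloured_nbrs v (K : seq C) :
  #|[set w | adj v w && (chi [set v; w] \in K)]| <= 2 * size K.
Proof.
elim: K => [|a K IHK].
  by rewrite (_ : [set _ | _] = set0) ?cards0 //; apply/setP=> w; rewrite !inE andbF.
rewrite (_ : [set _ | _] = [set w | adj v w && (chi [set v; w] == a)]
  :|: [set w | adj v w && (chi [set v; w] \in K)]); last first.
  by apply/setP=> w; rewrite !inE andb_orr.
by move: (cardsU_leq [set w | adj v w && (chi [set v; w] == a)]
  [set w | adj v w && (chi [set v; w] \in K)]) (chi_local v a) => /=; lia.
Qed.

Lemma card_coloured_edges (K : seq C) :
  #|[set e in graph_edges | chi e \in K]| <= #|V| * size K.
Proof.
elim: K => [|a K IHK].
  by rewrite (_ : [set _ in _ | _] = set0) ?cards0 //; apply/setP=> w; rewrite !inE andbF.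
rewrite (_ : [set _ in _ | _] = [set e in graph_edges | chi e == a]
  :|: [set e in graph_edges | chi e \in K]); last first.
  by apply/setP=> w; rewrite !inE andb_orr.
by rewrite /= mulnS (leq_trans (cardsU_leq _ _)) // leq_add.
Qed.

Lemma card_edges_meeting (l : seq V) :
  #|[set e in graph_edges | has (mem e) l]| <= #|V| * size l.
Proof.
elim: l => [|v l IHl].
  by rewrite (_ : [set _ in _ | _] = set0) ?cards0 //; apply/setP=> w; rewrite !inE andbF.
rewrite (_ : [set _ in _ | _] = [set e in graph_edges | v \in e]
  :|: [set e in graph_edges | has (mem e) l]); last first.
  by apply/setP=> w; rewrite !inE andb_orr.
by rewrite /= mulnS (leq_trans (cardsU_leq _ _)) // leq_add ?card_edges_at.
Qed.

(** * Close vertices and tours *)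

Context (d T m : nat).

Definition close x y := d <= #|[set w | adj x w && adj y w]|.

Lemma close_sym : symmetric close.
Proof.
by move=> x y; rewrite /close (_ : [set w | adj x w && _] = [set w | adj y w && adj x w]) //;
  apply/setP=> w; rewrite !inE andbC.
Qed.

(** Each colour of [K] rules out at most two common neighbours through [x] and two through [y],
    whence the factor 4. *)
Lemma close_connector x y (Z : {set V}) (K : seq C) :
  close x y -> #|Z| + 4 * size K < d ->
  exists w, [/\ adj x w, adj y w, w \notin Z,
    chi [set x; w] \notin K & chi [set y; w] \notin K].
Proof.
rewrite /close => cl small.
pose B u := [set w | adj u w && (chi [set u; w] \in K)].
have : ~~ ([set w | adj x w && adj y w] \subset Z :|: (B x :|: B y)).
  apply/negP=> /subset_leq_card.
  move: (cardsU_leq Z (B x :|: B y)) (cardsU_leq (B x) (B y)) => /=.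
  by move: (card_coloured_nbrs x K) (card_coloured_nbrs y K); rewrite -/(B x) -/(B y); lia.
case/subsetPn=> w; rewrite !inE => /andP[xw yw]; rewrite xw yw /= !negb_or.
by case/and3P=> ? ? ?; exists w.
Qed.

(* A path [x :: s] built backwards from the end [x]: it runs through the designated
   edges [Q] and joins them by detours through common neighbours.  The joining
   vertices avoid [Z], the joining edges avoid the colours [K]. *)
Record tour R (Z : {set V}) (K : seq C) x s Q : Prop := Tour {
  tour_path : path adj x s;
  tour_uniq : uniq (x :: s);
  tour_sub : Q \subset R;
  tour_size : size (x :: s) <= 3 * #|Q|;
  tour_mem : {in Q, forall e, e \in steps x s};
  tour_only : {in Q, forall e, {in steps x s, forall e', chi e' = chi e -> e' = e}};
  tour_vertex : {in x :: s, forall v, v \in Z -> exists2 e, e \in Q & v \in e};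
  tour_edge : {in steps x s, forall e, e \notin Q -> chi e \notin K};
  tour_end : exists2 e, e \in Q & x \in e
}.

Lemma tourS R R' Z K x s Q : R \subset R' -> tour R Z K x s Q -> tour R' Z K x s Q.
Proof. by move=> sR []; split=> //; apply: subset_trans sR. Qed.

Definition blocked x s e := has (mem e) (x :: s) || (chi e \in map chi (steps x s)).

(** Writing [e] as [yz], the tour is prolonged from [x] through a common neighbour [w] of [x] and
    [y], then [y], then [z], which becomes the new end. The joining edges [xw] and [wy] must avoid
    the colours of [e] and of [Q], but may repeat other colours, since only designated edges have to
    be isolated. *)
Lemma tour_extend R Z K x s Q e y :
  13 * m + 6 < d -> #|Z| <= 2 * m -> size K <= m ->
  tour R Z K x s Q -> #|Q| <= m -> R \subset graph_edges ->
  e \in R -> y \in e -> close x y -> ~~ blocked x s e ->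
  exists x' s', tour R Z K x' s' (e |: Q) /\ e \notin Q.
Proof.
move=> md mZ mK tQ Qm sR eR ye cl; rewrite negb_or => /andP[/hasPn disj colour].
have [z yz e_yz] := graph_edges_at (subsetP sR _ eR) ye.
have ynot : y \notin x :: s by apply/negP=> /disj; rewrite /= ye.
have znot : z \notin x :: s by apply/negP=> /disj; rewrite /= e_yz set22.
have eQ : e \notin Q.
  by apply: contra colour => /(tour_mem tQ) es; apply: map_f.
(* At most [2m + 3m + 2] vertices and [2m + 1] colours are forbidden; with four vertices lost per
   colour this makes [13m + 6], the constant in the hypothesis on [d]. *)
pose Z' := Z :|: [set v in x :: s] :|: [set y; z].
pose K' := K ++ chi e :: [seq chi f | f <- enum Q].
have [|w [xw yw wZ xwK ywK]] := @close_connector x y Z' K' cl.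
  have cZ : #|Z'| <= 2 * m + 3 * m + 2.
    apply: leq_trans (cardsU_leq _ _) _; apply: leq_add; last by rewrite cards2; case: eqP.
    apply: leq_trans (cardsU_leq _ _) _; apply: leq_add => //.
    rewrite cardsE; apply: leq_trans (card_size _) _; apply: leq_trans (tour_size tQ) _.
    by rewrite leq_mul2l Qm.
  have cK : size K' <= m + m.+1 by rewrite size_cat /= size_map -cardE leq_add.
  by move: cZ cK md; clear; lia.
move: wZ; rewrite !inE !negb_or -!andbA => /and5P[wZ wx ws wy wz].
move: xwK; rewrite mem_cat inE !negb_or => /and3P[xwK xwe xwQ].
move: ywK; rewrite mem_cat inE !negb_or => /and3P[ywK ywe ywQ].
have ezy : [set z; y] = e by rewrite e_yz setUC.
have ewx : [set w; x] = [set x; w] by rewrite setUC.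
have yzn : z != y by apply/eqP=> zy; move: yz; rewrite zy adj_irr.
exists z, (y :: w :: x :: s); split=> //; split.
- by rewrite /= adj_sym yz yw adj_sym xw (tour_path tQ).
- move: ynot znot (tour_uniq tQ); rewrite /= !inE !negb_or.
  move=> /andP[yx ys] /andP[zx zs] /andP[-> ->].
  by rewrite yzn zx zs yx ys wx ws (eq_sym z w) wz (eq_sym y w) wy.
- by rewrite subUset sub1set eR (tour_sub tQ).
- by rewrite cardsU1 eQ mulnDr; apply: (leq_add (leqnn 3) (tour_size tQ)).
- move=> f; rewrite in_setU1 /= ezy !inE => /orP[->//|/(tour_mem tQ)].
  by rewrite /steps => ->; rewrite !orbT.
- have inK f : f \in Q -> chi f \in [seq chi f | f <- enum Q].
    by move=> fQ; apply: map_f; rewrite mem_enum.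
  move=> f; rewrite in_setU1 => fQ g; rewrite /= ezy ewx !inE -/(steps x s).
  case/orP: fQ => [/eqP->{f}|fQ].
    case/or4P=> [/eqP->//|/eqP->|/eqP->|gs] eg.
    + by rewrite eg eqxx in ywe.
    + by rewrite eg eqxx in xwe.
    + by case/negP: colour; rewrite -eg map_f.
  case/or4P=> [/eqP->|/eqP->|/eqP->|gs] eg.
  + by case/negP: colour; rewrite eg map_f // (tour_mem tQ).
  + by rewrite eg inK in ywQ.
  + by rewrite eg inK in xwQ.
  + exact: (tour_only tQ).
- move=> v vs vZ; move: vs; rewrite in_cons => /orP[/eqP->|].
    by exists e; rewrite ?setU11 // e_yz set22.
  rewrite in_cons => /orP[/eqP->|]; first by exists e; rewrite ?setU11.
  rewrite in_cons => /orP[/eqP vw|vs]; first by rewrite vw (negPf wZ) in vZ.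
  have [f fQ vf] := tour_vertex tQ vs vZ.
  by exists f => //; rewrite setU1r.
- move=> f; rewrite /= ezy ewx !inE -/(steps x s) negb_or.
  case/or4P=> [/eqP->|/eqP->|/eqP->|fs] /andP[fe fQ] //; first by rewrite eqxx in fe.
  exact: (tour_edge tQ).
- by exists e; rewrite ?setU11 // e_yz set22.
Qed.

Lemma tour_start R Z K e : R \subset graph_edges -> e \in R ->
  exists x s, tour R Z K x s [set e].
Proof.
move=> sR eR; have /graph_edgesP[x [y [xy exy]]] := subsetP sR _ eR.
exists x, [:: y]; split=> //=.
- by rewrite xy.
- by rewrite inE andbT; apply/eqP=> xey; rewrite xey adj_irr in xy.
- by rewrite sub1set.
- by rewrite cards1.
- by move=> f /set1P->; rewrite inE exy.
- by move=> f /set1P-> g; rewrite inE exy => /eqP.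
- by move=> v; rewrite !inE => vxy _; exists e; rewrite ?set11 // exy in_set2.
- by move=> f; rewrite inE -exy => /eqP->; rewrite set11.
- by exists e; rewrite ?set11 // exy set21.
Qed.

Lemma maximal_tour R Z K :
  13 * m + 6 < d -> #|Z| <= 2 * m -> size K <= m ->
  R \subset graph_edges -> R != set0 ->
  exists x s Q, [/\ tour R Z K x s Q, Q != set0 & #|Q| = m.+1 \/
    #|Q| <= m /\ {in R, forall e, {in e, forall y, close x y -> blocked x s e}}].
Proof.
move=> md mZ mK sR /set0Pn[e0 e0R].
have [x0 [s0 t0]] := tour_start Z K sR e0R.
have Q0 : [set e0] != set0 by apply/set0Pn; exists e0; rewrite set11.
have c0 : #|[set e0]| <= m.+1 by rewrite cards1.
move: x0 s0 [set e0] t0 Q0 c0.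
(* Induction on the number of designated edges missing to reach [m + 1]. *)
suff H k x s Q : m.+1 - #|Q| <= k -> tour R Z K x s Q -> Q != set0 -> #|Q| <= m.+1 ->
  exists x s Q, [/\ tour R Z K x s Q, Q != set0 & #|Q| = m.+1 \/
    #|Q| <= m /\ {in R, forall e, {in e, forall y, close x y -> blocked x s e}}].
  by move=> x s Q; apply: (H (m.+1 - #|Q|)).
elim: k x s Q => [|k IHk] x s Q mQ tQ Qn Qm.
  by exists x, s, Q; split=> //; left; lia.
have [Qm1|Qm1] := eqVneq #|Q| m.+1; first by exists x, s, Q; split=> //; left.
have {Qm Qm1}Qm : #|Q| <= m by lia.
case: (boolP [exists e in R, exists y in e, close x y && ~~ blocked x s e]).
  case/exists_inP=> e eR /exists_inP[y ye /andP[cl nb]].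
  have [x' [s' [t' eQ]]] := tour_extend md mZ mK tQ Qm sR eR ye cl nb.
  apply: (IHk x' s' (e |: Q)) => //; rewrite ?cardsU1 ?eQ //; first by move: mQ; clear; lia.
  by apply/set0Pn; exists e; rewrite setU11.
move/exists_inPn=> H; exists x, s, Q; split=> //; right; split=> // e eR y ye cl.
by move/exists_inPn: (H e eR) => /(_ y ye); rewrite cl /= negbK.
Qed.

(** * Covering by tours, with deferred edges *)

Definition valid_path (p : V * seq V) := path adj p.1 p.2 && uniq (p.1 :: p.2).

Definition isolates (p : V * seq V) e :=
  e \in steps p.1 p.2 /\ {in steps p.1 p.2, forall e', chi e' = chi e -> e' = e}.

(** Second Bonferroni inequality for the neighbourhoods: their union has at most [#|V|] elements,
    and each pairwise intersection has fewer than [d]. *)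
Lemma sum_degrees_nonclose (ys : seq V) :
  pairwise (fun u v => ~~ close u v) ys ->
  \sum_(y <- ys) #|[set w | adj y w]| <= #|V| + 'C(size ys, 2) * d.
Proof.
pose U (l : seq V) := [set w | has (fun y => adj y w) l].
have inter y l : all (fun v => ~~ close y v) l -> #|[set w | adj y w] :&: U l| <= size l * d.
  elim: l => [|v l IHl] /=.
    by rewrite (_ : _ :&: _ = set0) ?cards0 //; apply/setP=> w; rewrite !inE andbF.
  rewrite /close -ltnNge => /andP[cl /IHl hl].
  rewrite (_ : _ :&: _ = [set w | adj y w && adj v w] :|: ([set w | adj y w] :&: U l)).
    by apply: leq_trans (cardsU_leq _ _) _; rewrite mulSn; apply: leq_add => //; apply: ltnW.
  by apply/setP=> w; rewrite !inE /= andb_orr.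
move=> pys; apply: (@leq_trans (#|U ys| + 'C(size ys, 2) * d)); last first.
  by rewrite leq_add2r max_card.
elim: ys pys => [|y ys IHys]; first by rewrite big_nil.
rewrite pairwise_cons => /andP[ally pys]; rewrite big_cons.
have -> : U (y :: ys) = [set w | adj y w] :|: U ys by apply/setP=> w; rewrite !inE.
have := cardsUI [set w | adj y w] (U ys); have := inter _ _ ally; have := IHys pys.
rewrite [size (_ :: _)]/= binS bin1 mulnDl.
set s1 := \sum_(_ <- _) _; move: s1 #|_ :|: _| #|_ :&: _| #|U ys| #|[set w | adj y w]| => *.
by lia.
Qed.

Context (close_bound : forall ys, pairwise (fun u v => ~~ close u v) ys -> size ys <= T).

(* The ends of the tours that get stuck are pairwise not close, so there are at
   most [T] of them; each forces at most [b] edges to be deferred to [R']. *)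
Lemma tour_cover R0 Z K b :
  13 * m + 6 < d -> #|Z| <= 2 * m -> size K <= m -> R0 \subset graph_edges ->
  (forall x s Q, tour R0 Z K x s Q -> #|Q| <= m ->
     #|[set e in R0 :\: Q | blocked x s e]| <= b) ->
  exists Ps R', [/\ all valid_path Ps, R' \subset R0,
    size Ps * m.+1 <= #|R0| + T * m.+1, #|R'| <= b * T &
    {in R0 :\: R', forall e, exists2 p, p \in Ps & isolates p e}].
Proof.
move=> md mZ mK sR0 hb.
(* The list [ys] collects the ends of the stuck tours so far, and no remaining edge has an end close
   to any of them. A full tour is paid for by the [m + 1] edges it removes from [R], a stuck one by
   one of the [T] places available in [ys]. *)
suff H k R ys : #|R| <= k -> R \subset R0 -> pairwise (fun u v => ~~ close u v) ys ->
    {in ys, forall y, {in R, forall e, {in e, forall v, ~~ close y v}}} ->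
  exists Ps R', [/\ all valid_path Ps, R' \subset R,
    size Ps * m.+1 + size ys * m.+1 <= #|R| + T * m.+1, #|R'| + b * size ys <= b * T &
    {in R :\: R', forall e, exists2 p, p \in Ps & isolates p e}].
  have [//|//|Ps [R' [v1 v2 v3 v4 v5]]] := H #|R0| R0 [::] (leqnn _) (subxx _).
  by exists Ps, R'; split=> //; move: v3 v4 => /=; lia.
elim: k R ys => [|k IHk] R ys Rk sR pys ysR; have ysT := close_bound pys.
  have R0e : R = set0 by apply/eqP; rewrite -cards_eq0; lia.
  exists [::], set0; split=> //; rewrite ?sub0set ?cards0 //=.
  - by rewrite add0n (leq_trans _ (leq_addl _ _)) // leq_mul2r ysT orbT.
  - by rewrite add0n leq_mul2l ysT orbT.
  - by move=> e; rewrite R0e !inE andbF.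
have [R0e|Rn] := eqVneq R set0.
  by apply: IHk; rewrite ?R0e ?cards0 -?R0e.
have sRE := subset_trans sR sR0.
have [x [s [Q [tQ Qn dich]]]] := maximal_tour md mZ mK sRE Rn.
have valid_x : valid_path (x, s) by rewrite /valid_path (tour_path tQ) (tour_uniq tQ).
have isol : {in Q, forall e, isolates (x, s) e}.
  by move=> e eQ; split; [apply: tour_mem tQ _ eQ | apply: tour_only tQ _ eQ].
have QR := tour_sub tQ; have Qpos : 0 < #|Q| by rewrite card_gt0.
have cRQ : #|R :\: Q| + #|Q| = #|R|.
  by rewrite cardsD (setIidPr QR) subnK // subset_leq_card.
case: dich => [Qm|[Qm stuck]].
  have [| | |Ps [R' [v1 v2 v3 v4 v5]]] := IHk (R :\: Q) ys _ _ pys.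
  - by move: cRQ Qpos Rk; clear; lia.
  - by apply: subset_trans sR; apply: subsetDl.
  - by move=> y yys e; rewrite inE => /andP[_ eR]; apply: ysR.
  exists ((x, s) :: Ps), R'; split=> //=.
  - by rewrite valid_x.
  - by apply: subset_trans v2 _; apply: subsetDl.
  - by rewrite mulSn -addnA -cRQ Qm [#|R :\: Q| + _]addnC -addnA leq_add2l.
  - move=> e; rewrite inE => /andP[eR' eR]; case: (boolP (e \in Q)) => eQ.
      by exists (x, s); [rewrite mem_head | apply: isol].
    have [|p pPs pe] := v5 e; first by rewrite !inE eR' eQ.
    by exists p; rewrite ?inE ?pPs ?orbT.
(* Deferring all blocked edges leaves only edges with no end close to [x], so [x] can join [ys]. *)
pose B := [set e in R :\: Q | blocked x s e].
have Bb : #|B| <= b.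
  apply: leq_trans (hb x s Q (tourS sR tQ) Qm); apply: subset_leq_card.
  by apply/subsetP=> e; rewrite !inE => /andP[/andP[-> /(subsetP sR)->]].
have [e0 e0Q xe0] := tour_end tQ.
have [| | | |Ps [R' [v1 v2 v3 v4 v5]]] := IHk ((R :\: Q) :\: B) (x :: ys).
- by have := subset_leq_card (subsetDl (R :\: Q) B); move: cRQ Qpos Rk; clear; lia.
- by apply: subset_trans sR; apply: subset_trans (subsetDl _ _) (subsetDl _ _).
(* The new end [x] lies on an edge of [Q], hence of [R], so it is close to no earlier end. *)
- rewrite /= pys andbT; apply/allP=> y yys; rewrite close_sym.
  exact: ysR (subsetP QR _ e0Q) _ xe0.
- move=> y; rewrite inE => /orP[/eqP->|yys] e; rewrite !inE.
    case/and3P=> eB eQ eR v ve; apply/negP=> /(stuck _ eR _ ve) bl.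
    by rewrite eQ eR bl in eB.
  by case/and3P=> _ _ eR; apply: ysR.
exists ((x, s) :: Ps), (B :|: R'); split=> //=.
- by rewrite valid_x.
- rewrite subUset (subset_trans v2) ?(subset_trans (subsetDl _ _) (subsetDl _ _)) //.
  by rewrite andbT; apply/subsetP=> e; rewrite !inE => /andP[/andP[]].
- rewrite mulSn addnAC addnC -mulSn -cRQ; apply: leq_trans v3 _; rewrite leq_add2r.
  by apply: leq_trans (leq_addr _ _); apply/subset_leq_card/subsetDl.
- apply: leq_trans v4; rewrite /= mulnS addnA leq_add2r addnC.
  by apply: leq_trans (cardsU_leq _ _) _; rewrite leq_add2r.
- move=> e; rewrite in_setD in_setU negb_or => /andP[/andP[eB eR'] eR].
  case: (boolP (e \in Q)) => eQ.
    by exists (x, s); [rewrite mem_head | apply: isol].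
  have [|p pPs pe] := v5 e; first by rewrite in_setD eR' in_setD eB in_setD eQ.
  by exists p; rewrite ?inE ?pPs ?orbT.
Qed.

(** The tour has at most [3m] vertices and at most [3m] colours; each vertex and each colour
    accounts for at most [#|V|] edges. *)
Lemma blocked_bound R x s Q : R \subset graph_edges -> tour R set0 [::] x s Q ->
  #|Q| <= m -> #|[set e in R :\: Q | blocked x s e]| <= #|V| * (6 * m).
Proof.
move=> sR tQ Qm.
have size_s : size (x :: s) <= 3 * m.
  by apply: leq_trans (tour_size tQ) _; rewrite leq_mul2l Qm.
have sub : [set e in R :\: Q | blocked x s e] \subset
    [set e in graph_edges | has (mem e) (x :: s)]
    :|: [set e in graph_edges | chi e \in map chi (steps x s)].
  apply/subsetP=> e /setIdP[/setDP[/(subsetP sR) eG _] /orP bl].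
  by apply/setUP; case: bl => bl; [left | right]; apply/setIdP.
apply: leq_trans (subset_leq_card sub) _; apply: leq_trans (cardsU_leq _ _) _.
rewrite (_ : 6 * m = 3 * m + 3 * m); last by lia.
rewrite mulnDr; apply: leq_add.
  by apply: leq_trans (card_edges_meeting _) _; rewrite leq_mul2l size_s orbT.
apply: leq_trans (card_coloured_edges _) _; rewrite size_map size_pairmap leq_mul2l.
by rewrite (leq_trans _ size_s) ?orbT //= ltnW.
Qed.

(** * Splitting the deferred edges into matchings *)

Definition conflict e (f : {set V}) := has (mem e) (enum f) || (chi e == chi f).

Lemma conflict_sym : symmetric conflict.
Proof.
move=> e f; rewrite /conflict (eq_sym (chi e)); congr (_ || _).
by apply/hasP/hasP=> -[v]; rewrite mem_enum /= => *; exists v; rewrite ?mem_enum.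
Qed.

(** The two ends of [e] account for [2 * #|V|] edges and its colour class for another [#|V|]. *)
Lemma card_conflict e D : D \subset graph_edges -> e \in D ->
  #|[set f in D | conflict e f]| <= 3 * #|V|.
Proof.
move=> sD eD; have /graph_edgesP[x [y [xy exy]]] := subsetP sD _ eD.
have sub : [set f in D | conflict e f] \subset
    [set f in graph_edges | has (mem f) [:: x; y]]
    :|: [set f in graph_edges | chi f == chi e].
  apply/subsetP=> f /setIdP[/(subsetP sD) fG]; rewrite conflict_sym => /orP[/hasP[v]|fe].
    rewrite mem_enum exy in_set2 => vxy vf; apply/setUP; left; apply/setIdP; split=> //.
    by apply/hasP; exists v; rewrite // !inE.
  by apply/setUP; right; apply/setIdP.
apply: leq_trans (subset_leq_card sub) _; apply: leq_trans (cardsU_leq _ _) _.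
rewrite (_ : 3 * #|V| = #|V| * 2 + #|V|); last by rewrite mulnC mulnS addnC.
by apply: leq_add; [apply: card_edges_meeting | apply: chi_class].
Qed.

(* A matching with distinct colours never blocks a tour that avoids its vertices
   and colours, so nothing is deferred. *)
Lemma matching_cover D : 13 * m + 6 < d -> D \subset graph_edges -> #|D| <= m ->
  {in D &, forall e e', e != e' -> ~~ conflict e e'} ->
  exists Ps, [/\ all valid_path Ps, size Ps <= T &
    {in D, forall e, exists2 p, p \in Ps & isolates p e}].
Proof.
move=> md sD Dm matchD.
have [| | | Ps [R' [v1 v2 v3 v4 v5]]] :=
    @tour_cover D (cover D) [seq chi e | e <- enum D] 0 md _ _ sD.
- apply: leq_trans (leq_card_cover _) _; apply: (@leq_trans (\sum_(e in D) 2)).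
    apply: leq_sum => e /(subsetP sD) /graph_edgesP[x [y [_ ->]]].
    by rewrite cards2; case: eqP.
  by rewrite sum_nat_const mulnC leq_mul2l.
- by rewrite size_map -cardE.
- move=> x s Q tQ Qm; rewrite leqn0 cards_eq0; apply/eqP/setP=> e.
  rewrite [RHS]inE; apply/negP; rewrite !inE => /andP[/andP[eQ eD]].
  have clash f : f \in Q -> ~~ conflict e f.
    move=> fQ; apply: matchD => //; first exact: subsetP (tour_sub tQ) _ fQ.
    by apply: contraNneq eQ => ->.
  (* A common vertex lies in [cover D], hence on an edge of [Q], which would conflict with [e]. A
     common colour comes either from an edge of [Q], again a conflict, or from a joining edge, whose
     colour avoids those of [D]. *)
  case/orP=> [/hasP[v vs ve]|/mapP[g gs eg]].
    have [|f fQ vf] := tour_vertex tQ vs; first by apply/bigcupP; exists e.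
    by move/negP: (clash f fQ); apply; apply/orP; left; apply/hasP; exists v; rewrite ?mem_enum.
  case: (boolP (g \in Q)) => gQ.
    by move/negP: (clash g gQ); apply; rewrite /conflict eg eqxx orbT.
  by move/negP: (tour_edge tQ gs gQ); apply; rewrite -eg map_f // mem_enum.
have R'0 : R' = set0 by apply/eqP; rewrite -cards_eq0 -leqn0.
exists Ps; split=> // [|e eD]; last by apply: v5; rewrite R'0 !inE eD.
(* Since [#|D| <= m], the count is below [(T + 1)(m + 1)], so at most [T] tours are used. *)
rewrite -ltnS -(ltn_pmul2r (ltn0Sn m)) mulSn; apply: leq_ltn_trans v3 _.
by rewrite ltn_add2r ltnS.
Qed.

Lemma isolating_cover : 0 < m -> 13 * m + 6 < d ->
  exists Ps, [/\ all valid_path Ps,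
    size Ps * m.+1 <= #|V| ^ 2 + T * (6 * #|V| * T + 3 * #|V| + 2) * m.+1 &
    {in graph_edges, forall e, exists2 p, p \in Ps & isolates p e}].
Proof.
move=> m0 md.
have [| |x s Q|Ps1 [D [v1 v2 v3 v4 v5]]] :=
  @tour_cover graph_edges set0 [::] (#|V| * (6 * m)) md _ _ (subxx _).
- by rewrite cards0.
- by [].
- exact: blocked_bound.
(* There are at most [6m * #|V| * T] deferred edges, so at most [L] classes of size [m] can be full;
   [N] is the least number of colours the greedy colouring accepts. *)
pose L := 6 * #|V| * T; pose N := (3 * #|V| + L).+1.
have DL : #|D| <= L * m by apply: leq_trans v4 _; rewrite /L; nia.
have [|f [fr fb]] :=
  @bounded_proper_colouring _ conflict D (3 * #|V|) m L N conflict_sym _ m0 DL (ltnSn _).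
  by move=> e; apply: card_conflict.
have sub i : [set e in D | f e == i] \subset graph_edges.
  by apply/subsetP=> e; rewrite inE => /andP[/(subsetP v2)].
have hP i : exists Ps, [/\ all valid_path Ps, size Ps <= T &
    {in [set e in D | f e == i], forall e, exists2 p, p \in Ps & isolates p e}].
  apply: matching_cover => // e e'; rewrite !inE => /andP[eD /eqP fe] /andP[e'D /eqP fe'].
  by apply: fr => //; rewrite fe fe'.
have [Ps2 [w1 w2 w3]] : exists Ps, [/\ all valid_path Ps, size Ps <= T * N &
    {in D, forall e, exists2 p, p \in Ps & isolates p e}].
  suff H (l : seq 'I_N) : exists Ps, [/\ all valid_path Ps, size Ps <= T * size l &
      {in D, forall e, f e \in l -> exists2 p, p \in Ps & isolates p e}].
    have [Ps [w1 w2 w3]] := H (enum 'I_N); exists Ps; split=> //.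
      by rewrite -[N]card_ord cardE.
    by move=> e eD; apply: w3; rewrite ?mem_enum.
  elim: l => [|i l [Ps [w1 w2 w3]]]; first by exists [::].
  have [Qs [q1 q2 q3]] := hP i; exists (Qs ++ Ps); split=> [||e eD].
  - by rewrite all_cat q1.
  - by rewrite size_cat /= mulnS leq_add.
  - rewrite inE => /orP[fe|fe].
      have [|p pQ pe] := q3 e; first by rewrite inE eD.
      by exists p; rewrite ?mem_cat ?pQ.
    have [p pP pe] := w3 e eD fe.
    by exists p; rewrite ?mem_cat ?pP ?orbT.
exists (Ps1 ++ Ps2); split=> [||e eE].
- by rewrite all_cat v1.
- have c2 := card_graph_edges.
  have h2 : size Ps2 * m.+1 <= T * N * m.+1 by rewrite leq_mul2r w2 orbT.
  rewrite size_cat mulnDl; apply: leq_trans (leq_add v3 h2) _.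
  (* The [T] extra tours of the first round join the [T * N] of the second: [1 + N] is the bracket
     of the statement. *)
  rewrite -addnA -mulnDl -{1}[T]muln1 -mulnDr; apply: leq_add => //.
  by rewrite leq_mul2r /N /L -addnS !leq_mul2l; apply/orP; right; apply/orP; right; lia.
- case: (boolP (e \in D)) => eD.
    by have [p pP pe] := w3 e eD; exists p; rewrite ?mem_cat ?pP ?orbT.
  have [|p pP pe] := v5 e; first by rewrite inE eD eE.
  by exists p; rewrite ?mem_cat ?pP.
Qed.

End Cover.

(** * Separation from two isolating covers *)

Lemma separating_paths {V : finType} (adj : rel V) (d T m : nat) :
  symmetric adj -> irreflexive adj ->
  (forall ys, pairwise (fun u v => ~~ close adj d u v) ys -> size ys <= T)%N ->
  (0 < m -> 13 * m + 6 < d ->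
  exists Ps : seq (V * seq V), [/\ all (valid_path adj) Ps,
    size Ps * m.+1 <= 2 * (#|V| ^ 2 + T * (6 * #|V| * T + 3 * #|V| + 2) * m.+1) &
    {in graph_edges adj &, forall e e', e != e' ->
      exists2 p, p \in Ps & (e \in steps p.1 p.2) != (e' \in steps p.1 p.2)}])%N.
Proof.
move=> asym airr cb m0 md.
(* Under [id] every colour class is a single edge at most, so isolating an edge just means covering
   it. *)
have [v a|a|Ps1 [v1 s1 c1]] := @isolating_cover V _ adj id asym airr _ _ d T m cb m0 md.
- rewrite (leq_trans _ (leqnSn 1)) //; apply/card_le1P=> w; rewrite inE => /andP[vw /eqP ew] w'.
  rewrite inE; apply/andP/eqP=> [[vw' /eqP ew']|->]; last by rewrite vw ew.
  by move: ew'; rewrite -ew => /set2_inj[[]|[vw'' ?]] //; rewrite -vw'' airr in vw.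
- have [V0|V0] := posnP #|V|.
    rewrite V0 leqn0 cards_eq0; apply/eqP/setP=> e; rewrite [RHS]inE; apply/negP.
    by case/setIdP=> /graph_edgesP[x]; have := card0_eq V0 x; rewrite inE.
  apply: leq_trans V0; apply/card_le1P=> e /setIdP[eG /eqP ea] e'.
  rewrite [RHS]inE; apply/setIdP/eqP=> [[_ /eqP]|->]; first by rewrite -ea.
  by rewrite ea; split=> //; rewrite -ea.
(* The index of the first path through [e]; the value [size Ps1], meaning that there is none, is
   excluded for edges by [chi_lt]. *)
pose chi e := find (fun p : V * seq V => e \in steps p.1 p.2) Ps1.
have chi_lt e : e \in graph_edges adj -> (chi e < size Ps1)%N.
  by move=> /c1[p pP [pe _]]; rewrite /chi -has_find; apply/hasP; exists p.
have chi_mem e x0 : e \in graph_edges adj ->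
    e \in steps (nth x0 Ps1 (chi e)).1 (nth x0 Ps1 (chi e)).2.
  by move=> /chi_lt; rewrite /chi -has_find => /(nth_find x0).
have valid_nth a x0 : (a < size Ps1)%N -> valid_path adj (nth x0 Ps1 a).
  by move=> lta; apply: (allP v1); apply: mem_nth.
have [v a|a|Ps2 [v2 s2 c2]] := @isolating_cover V _ adj chi asym airr _ _ d T m cb m0 md.
- have [lta|lea] := ltnP a (size Ps1); last first.
    rewrite (_ : [set _ | _] = set0) ?cards0 //; apply/setP=> w; rewrite !inE.
    apply/negP=> /andP[vw /eqP chia]; have := chi_lt [set v; w]; rewrite chia ltnNge lea.
    by move=> /(_ _)/negP; apply=> //; apply/graph_edgesP; exists v, w.
  have /andP[_ un] := valid_nth a (v, [::]) lta.
  apply: leq_trans (steps_degree v un); apply/subset_leq_card/subsetP=> w.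
  rewrite !inE => /andP[vw /eqP <-]; apply: chi_mem.
  by apply/graph_edgesP; exists v, w.
- have [lta|lea] := ltnP a (size Ps1); last first.
    rewrite (_ : [set _ in _ | _] = set0) ?cards0 //; apply/setP=> e; rewrite [RHS]inE.
    by apply/negP=> /setIdP[/chi_lt lte /eqP ea]; rewrite ea ltnNge lea in lte.
  have p0 : V * seq V by case: (Ps1) lta.
  have := valid_nth a p0 lta; case ep: (nth p0 Ps1 a) => [x s] /andP[_ un].
  (* A colour class lies on a single path, which has fewer edges than vertices. *)
  apply: (@leq_trans (size (x :: s))).
    apply: (@leq_trans #|[set e in steps x s]|).
      apply/subset_leq_card/subsetP=> e /setIdP[eE /eqP ea]; rewrite inE.
      by have := chi_mem e p0 eE; rewrite ea ep.
    rewrite cardsE; apply: leq_trans (card_size _) _; rewrite size_pairmap; exact: leqnSn.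
  by rewrite -(card_uniqP un) max_card.
exists (Ps1 ++ Ps2); split.
- by rewrite all_cat v1.
- by rewrite size_cat mulnDl mul2n -addnn leq_add.
move=> e e' eE e'E ee'; have [chiE|] := eqVneq (chi e) (chi e').
  have [p pP [pe only]] := c2 e eE; exists p; first by rewrite mem_cat pP orbT.
  rewrite pe eq_sym eqb_id; apply/negP=> pe'; case/eqP: ee'.
  by rewrite (only e' pe').
(* By symmetry [e] has the smaller index; its first path comes before every path through [e']. *)
wlog lt : e e' eE e'E {ee'} / (chi e < chi e')%N => [wl|_].
  rewrite neq_ltn => /orP[lt|lt].
    by apply: wl => //; rewrite neq_ltn lt.
  have [|p pP] := wl e' e e'E eE lt; first by rewrite neq_ltn lt.
  by rewrite eq_sym => *; exists p.
have p0 : V * seq V by case: (Ps1) (chi_lt e eE).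
exists (nth p0 Ps1 (chi e)); first by rewrite mem_cat mem_nth ?chi_lt.
by rewrite chi_mem // (before_find p0 lt).
Qed.

(** * Numerical bounds and choice of parameters *)

Local Open Scope ring_scope.

(** For [k = T + 1] pairwise non-close vertices, Bonferroni gives [kcn <= n + kTd/2]. Here [Tc <= 2]
    bounds the last term by [kcn/2], and [kc > 2] gives [n < kcn/2], a contradiction. *)
Lemma nonclose_bound (R : realType) (c : R) (V : finType) (adj : rel V) (d T : nat) :
  0 < c -> (0 < #|V|)%N ->
  (forall v, c * #|V|%:R <= #|[set u | adj v u]|%:R) ->
  d%:R <= c ^+ 2 * #|V|%:R / 2 -> T%:R <= 2 / c < T.+1%:R ->
  forall ys, pairwise (fun u v => ~~ close adj d u v) ys -> (size ys <= T)%N.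
Proof.
move=> c0 n0 deg hd /andP[hT1 hT2] ys pys; rewrite leqNgt; apply/negP=> ltT.
have := sum_degrees_nonclose (subseq_pairwise (take_subseq ys T.+1) pys).
rewrite size_takel // -(ler_nat R) natrD natrM natr_sum; apply/negP; rewrite -ltNge.
have n0' : 0 < #|V|%:R :> R by rewrite ltr0n.
set n := #|V|%:R in deg hd n0' *.
have lower : T.+1%:R * (c * n) <= \sum_(y <- take T.+1 ys) #|[set w | adj y w]|%:R.
  rewrite -[X in X%:R * _](size_takel ltT).
  elim: (take _ _) => [|y l IHl]; first by rewrite mul0r big_nil.
  by rewrite big_cons /= -natr1 mulrDl mul1r addrC lerD.
apply: lt_le_trans lower.
have binE : 'C(T.+1, 2)%:R = T.+1%:R * T%:R / 2 :> R.
  apply: (@mulIf _ 2); rewrite ?pnatr_eq0 // divfK ?pnatr_eq0 // -!natrM.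
  by congr _%:R; rewrite mulnC -(mul_bin_diag T.+1 1) bin1.
rewrite binE; set k := T.+1%:R in hT2 *; set t := T%:R in hT1 *.
have t0 : 0 <= t by apply: ler0n.
have k0 : 0 < k by apply: ltr0Sn.
have ct : t * c <= 2 by rewrite -ler_pdivlMr.
have ck : 2 < k * c by rewrite -ltr_pdivrMr.
have h1 : k * t / 2 * d%:R <= k * t / 2 * (c ^+ 2 * n / 2).
  by rewrite ler_wpM2l // divr_ge0 ?mulr_ge0 // ltW.
have h2 : (t * c) * (k * c * n) <= 2 * (k * c * n).
  by rewrite ler_wpM2r // !mulr_ge0 // ltW.
have h3 : 2 * n < k * c * n by rewrite ltr_pM2r.
lra.
Qed.

(** After multiplication by [c ^+ 2] and division by [M], the quadratic term gives at most [54n] and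
    the rest at most [60n + 8], which is at most [62n] as [n >= 4]. The sum [116n] is below
    [122n]. *)
Lemma path_count_bound (R : realType) (c : R) (n T M N : nat) :
  0 < c -> c <= 1 -> T%:R <= 2 / c -> (0 < M)%N -> (4 <= n)%N ->
  c ^+ 2 * n%:R / 27 <= M%:R ->
  (N * M <= 2 * (n ^ 2 + T * (6 * n * T + 3 * n + 2) * M))%N ->
  N%:R <= 122 * n%:R / c ^+ 2.
Proof.
move=> c0 c1 hT M0 n4 hM; rewrite -(ler_nat R) !(natrM, natrD, natrX) => hN.
have M0' : 0 < M%:R :> R by rewrite ltr0n.
have n4' : 4 <= n%:R :> R by rewrite ler_nat.
have t0 : 0 <= T%:R :> R by apply: ler0n.
have c20 : 0 < c ^+ 2 by rewrite exprn_gt0.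
rewrite ler_pdivlMr // -(ler_pM2r M0').
move: M%:R N%:R n%:R T%:R M0' n4' t0 hT hM hN => x y z t x0 z4 t0 ht hx hy.
have ct : t * c <= 2 by rewrite -ler_pdivlMr.
have z0 : 0 <= z by lra.
have h1 : c ^+ 2 * (y * x) <=
    c ^+ 2 * (2 * (z ^+ 2 + t * (6 * z * t + 3 * z + 2) * x)).
  by rewrite ler_pM2l.
have h2 : c ^+ 2 * z * z <= 27 * x * z by rewrite ler_wpM2r //; lra.
have u0 : 0 <= t * c by rewrite mulr_ge0 // ltW.
have h3 : t * c * (6 * z * (t * c) + 3 * z * c + 2 * c) <= 2 * (15 * z + 2).
  have zu : z * (t * c) <= z * 2 by rewrite ler_wpM2l.
  have zu0 : 0 <= z * (t * c) by rewrite mulr_ge0.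
  have zc : z * c <= z by rewrite ler_piMr.
  have zc0 : 0 <= z * c by rewrite mulr_ge0 // ltW.
  by apply: ler_pM => //; lra.
have h4 := ler_wpM2r (ltW x0) h3.
have h5 : 4 * x <= z * x by rewrite ler_pM2r.
lra.
Qed.

Theorem theorem1p3 (R : realType) (c : R) (hc : 0 < c) :
  exists n0 : nat, forall (n : nat) (adj : rel 'I_n),
    (n0 <= n)%N -> simple_graph adj ->
    min_degree_ge adj (c * n%:R) ->
    exists P : {set {set {set 'I_n}}},
      separating_path_system adj P /\
      (#|P|)%:R <= 122 * n%:R / c ^+ 2.
Proof.
have c20 : 0 < c ^+ 2 by rewrite exprn_gt0.
(* Since [702 = 26 * 27], the condition [c ^+ 2 * n >= 702] turns the bound
   [m + 1 >= c ^+ 2 * n / 26 - 1] into [m + 1 >= c ^+ 2 * n / 27]. It also yields [d >= 351]. *)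
exists (Num.truncn (702 / c ^+ 2)).+1 => n adj hn [asym airr] deg.
have nlarge : 702 <= c ^+ 2 * n%:R.
  rewrite mulrC -ler_pdivrMr //; apply/ltW/(lt_le_trans (truncnS_gt _)).
  by rewrite ler_nat.
have n0 : (0 < n)%N by apply: leq_trans hn.
have n0' : 0 < n%:R :> R by rewrite ltr0n.
have c1 : c <= 1.
  rewrite -(ler_pM2r n0') mul1r; apply: le_trans (deg (Ordinal n0)) _.
  by rewrite ler_nat -[leqRHS]card_ord max_card.
have n4 : (4 <= n)%N.
  rewrite -(ler_nat R); have : c ^+ 2 * n%:R <= n%:R by rewrite ler_piMl ?exprn_ile1 // ltW.
  lra.
pose T := Num.truncn (2 / c); pose d := Num.truncn (c ^+ 2 * n%:R / 2).
have hT : T%:R <= 2 / c < T.+1%:R by apply: truncn_itv; rewrite divr_ge0 // ltW.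
have /andP[hd1 hd2] : d%:R <= c ^+ 2 * n%:R / 2 < d.+1%:R.
  by apply: truncn_itv; lra.
have d351 : (350 < d)%N.
  by rewrite -ltnS -(ltr_nat R); lra.
have [m [m0 md dm]] : exists m, [/\ 0 < m, 13 * m + 6 < d & d < 13 * m.+2]%N.
  (* Taking one less than the quotient by 13 leaves room for the additive 6. *)
  by move: (d) d351; clear=> k hk; exists (k %/ 13).-1; split; lia.
have hM : c ^+ 2 * n%:R / 27 <= m.+1%:R.
  have : d.+1%:R <= (13 * m.+2)%:R :> R by rewrite ler_nat.
  rewrite natrM -natr1 -(natr1 m.+1); lra.
have nonclose ys : pairwise (fun u v => ~~ close adj d u v) ys -> (size ys <= T)%N.
  by apply: (@nonclose_bound R c) => //; rewrite ?card_ord.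
have [Ps [vPs sPs sepPs]] := separating_paths asym airr nonclose m0 md.
exists [set F in [seq [set e in steps p.1 p.2] | p <- Ps]]; split; first split.
- move=> F; rewrite inE => /mapP[[x s] pP ->].
  have /andP[px us] := allP vPs _ pP; exists x, s; split=> //.
  apply/setP=> e; rewrite inE /= stepsE.
  by apply/mapP/imsetP => -[p pz ->]; exists p.
- move=> e e' eE e'E ee'; have [p pP sep] := sepPs e e' eE e'E ee'.
  by exists [set e in steps p.1 p.2]; rewrite !inE // map_f.
apply: (@le_trans _ _ (size Ps)%:R).
  by rewrite ler_nat cardsE; apply: leq_trans (card_size _) _; rewrite size_map.
move: sPs; rewrite card_ord => sPs.
by apply: (path_count_bound hc c1 _ _ n4 hM sPs); case/andP: hT.
Qed.
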